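(* Let $v \geq 3$. Suppose that there exists a Kirkman triple system of order $3v$ which has an equitable $3$-colouring. Then there exists a Kirkman triple system of order $9v$ which has an equitable $3$-colouring.
   Context: A Kirkman triple system KTS$(n)$ is a Steiner triple system on $n$ points (every pair of points in exactly one triple) together with a partition of its triples into parallel classes (sets of triples partitioning the point set). A $3$-colouring is a map from the points to a set of $3$ colours such that no triple is monochromatic. A colouring is equitable if the sizes of its colour classes differ pairwise by at most one. *)

(* Defs.v *)
From mathcomp Require Import all_boot.

Set Implicit Arguments.
Unset Strict Implicit.
Unset Printing Implicit Defensive.

Definition steiner_triple_system (T : finType) (B : {set {set T}}) : Prop :=
  (forall b : {set T}, b \in B -> #|b| = 3) /\
  (forall x y : T, x != y -> #|[set b in B | [set x; y] \subset b]| = 1).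

Definition parallel_class (T : finType) (C : {set {set T}}) : Prop :=
  partition C [set: T].

(* B is the set of triples and P the set of parallel classes. *)
Definition kirkman_triple_system (T : finType)
    (B : {set {set T}}) (P : {set {set {set T}}}) : Prop :=
  [/\ steiner_triple_system B,
      partition P B
    & forall C : {set {set T}}, C \in P -> parallel_class C].

Definition monochromatic (T : finType) (k : nat) (c : T -> 'I_k)
    (b : {set T}) : Prop :=
  exists i : 'I_k, forall x : T, x \in b -> c x = i.

Definition colouring (T : finType) (B : {set {set T}}) (k : nat)
    (c : T -> 'I_k) : Prop :=
  forall b : {set T}, b \in B -> ~ monochromatic c b.

Definition colour_class (T : finType) (k : nat) (c : T -> 'I_k)
    (i : 'I_k) : {set T} := [set x | c x == i].

Definition equitable (T : finType) (k : nat) (c : T -> 'I_k) : Prop :=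
  forall i j : 'I_k, #|colour_class c i| <= #|colour_class c j| + 1.

Definition exists_equitably_3_colourable_KTS (n : nat) : Prop :=
  exists (T : finType) (B : {set {set T}}) (P : {set {set {set T}}}),
    [/\ #|T| = n,
        kirkman_triple_system B P
      & exists c : T -> 'I_3, colouring B c /\ equitable c].

(* Main.v *)
Require Import Defs.
From mathcomp Require Import all_boot.
From mathcomp Require Import all_algebra zify.
From HB Require Import structures.

Set Implicit Arguments.
Unset Strict Implicit.
Unset Printing Implicit Defensive.

(** Three copies of the given system are joined by a transversal design. A
    Kirkman triple system has odd order, so the three colour classes have the
    same odd size v, and the points can be labelled by the group
    G = Z/3 x Z/v in such a way that the first coordinate is the colour. The
    transversal triples are those with labels a, b, c, one in each copy, such
    that a + b + c = (1, 0). Doubling is a bijection of G, so for every d the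
    triples with a - b = d form a parallel class. In a transversal triple the
    colours add up to 1 in Z/3, whereas three equal colours add up to 0. *)

(** * Partitions as families that cover each point exactly once *)

Section Partitions.

Variable T : finType.

(** This is the form in which every partition below is verified: two members that share a point
    coincide, which is disjointness. *)
Lemma partition_of_unique_cover (P : {set {set T}}) (D : {set T}) :
  set0 \notin P ->
  (forall A, A \in P -> A \subset D) ->
  (forall x, x \in D -> exists2 A, A \in P & x \in A) ->
  (forall x A A', A \in P -> A' \in P -> x \in A -> x \in A' -> A = A') ->
  partition P D.
Proof.
move=> P0 PD ex uq; rewrite /partition P0 andbT; apply/andP; split.
  rewrite eqEsubset; apply/andP; split; first by apply/bigcupsP => A /PD.
  by apply/subsetP => x /ex[A AP xA]; apply/bigcupP; exists A.
apply/trivIsetP => A A' AP A'P; apply: contraNT => /pred0Pn[x /andP[xA xA']].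
by apply/eqP; apply: (uq x).
Qed.

Lemma partition_mem_unique (P : {set {set T}}) (D : {set T}) x A A' :
  partition P D -> A \in P -> A' \in P -> x \in A -> x \in A' -> A = A'.
Proof.
case/and3P=> _ tI _ AP A'P xA xA'.
by rewrite -(def_pblock tI AP xA) -(def_pblock tI A'P xA').
Qed.

Lemma partition_mem_cover (P : {set {set T}}) (D : {set T}) x :
  partition P D -> x \in D -> exists2 A, A \in P & x \in A.
Proof. by case/and3P=> /eqP <- _ _ /bigcupP[A AP xA]; exists A. Qed.

End Partitions.

(** * Steiner triple systems: the block through two points, parity of the order *)

Section Steiner.

Variables (T : finType) (B : {set {set T}}).

Lemma pair_subset (x y : T) (b : {set T}) :
  ([set x; y] \subset b) = (x \in b) && (y \in b).
Proof. by rewrite subUset !sub1set. Qed.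

Lemma steiner_of_unique_block :
  (forall b : {set T}, b \in B -> #|b| = 3) ->
  (forall x y, x != y -> exists2 b : {set T}, b \in B & (x \in b) && (y \in b)) ->
  (forall x y (b b' : {set T}), x != y -> b \in B -> b' \in B ->
     (x \in b) && (y \in b) -> (x \in b') && (y \in b') -> b = b') ->
  steiner_triple_system B.
Proof.
move=> B3 ex uq; split=> // x y xy.
have [b bB xyb] := ex _ _ xy; apply/eqP/cards1P; exists b.
apply/setP => b'; rewrite !inE pair_subset; apply/andP/eqP => [[b'B xyb']|->] //.
exact: (uq x y).
Qed.

Hypothesis stsB : steiner_triple_system B.

Lemma steiner_block x y : x != y ->
  exists2 b : {set T}, b \in B & (x \in b) && (y \in b).
Proof.
move=> xy; have /eqP/cards1P[b /setP/(_ b)] := stsB.2 _ _ xy.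
by rewrite !inE eqxx pair_subset => /andP[bB xyb]; exists b.
Qed.

Lemma steiner_block_unique x y (b b' : {set T}) :
  x != y -> b \in B -> b' \in B ->
  (x \in b) && (y \in b) -> (x \in b') && (y \in b') -> b = b'.
Proof.
move=> xy bB b'B xyb xyb'; have /eqP/cards1P[b0 /setP eqb] := stsB.2 _ _ xy.
have /eqP-> : b == b0 by rewrite -in_set1 -eqb !inE pair_subset bB.
by apply/esym/eqP; rewrite -in_set1 -eqb !inE pair_subset b'B.
Qed.

Lemma steiner_block_neq0 (b : {set T}) : b \in B -> exists x, x \in b.
Proof. by move/stsB.1 => b3; apply/set0Pn; rewrite -cards_eq0 b3. Qed.

(* The triples through x, with x removed, split the other points into pairs. *)
Lemma steiner_order_odd (x : T) : odd #|T|.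
Proof.
have pT : partition [set b :\ x | b in [set b in B | x \in b]] [set~ x].
  apply: partition_of_unique_cover.
  - apply/imsetP => -[b]; rewrite inE => /andP[bB xb] b0.
    by have := cardsD1 x b; rewrite -b0 cards0 xb stsB.1.
  - move=> A /imsetP[b _ ->]; apply/subsetP => y; rewrite !inE.
    by case/andP.
  - move=> y; rewrite !inE => yx; have xy : x != y by rewrite eq_sym.
    have [b bB /andP[xb yb]] := steiner_block xy.
    exists (b :\ x); last by rewrite !inE yx.
    by apply/imsetP; exists b; rewrite // inE bB.
  - move=> y A A' /imsetP[b]; rewrite inE => /andP[bB xb] -> /imsetP[b'].
    rewrite inE => /andP[b'B xb'] ->; rewrite !inE => /andP[yx yb] /andP[_ yb'].
    by rewrite (steiner_block_unique (x := y) (y := x) yx bB b'B) // ?yb ?yb'.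
have u2 : {in [set b :\ x | b in [set b in B | x \in b]], forall A : {set T}, #|A| = 2}.
  move=> A /imsetP[b]; rewrite inE => /andP[bB xb] ->.
  by have := cardsD1 x b; rewrite xb (stsB.1 _ bB); case.
have := card_uniform_partition u2 pT; rewrite cardsC1.
have : 0 < #|T| by apply/card_gt0P; exists x.
lia.
Qed.

End Steiner.

(** * Tripling a Kirkman system by a transversal design over an abelian group *)

Section Tripling.

Import GRing.Theory.
Local Open Scope ring_scope.

Variables (T : finType) (B : {set {set T}}) (P : {set {set {set T}}}).
Hypothesis ktsBP : kirkman_triple_system B P.
Variables (G : finZmodType) (f : T -> G) (g : G -> T) (s : G).
Hypotheses (fK : cancel f g) (gK : cancel g f).
Hypothesis double_bij : bijective (fun a : G => a + a).

Let stsB : steiner_triple_system B. Proof. by case: ktsBP. Qed.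

Definition level_triple (i : 'I_3) (b : {set T}) : {set T * 'I_3} :=
  [set p | (p.1 \in b) && (p.2 == i)].

(** The third label makes the sum equal to [s], which stays arbitrary here and is fixed only for the
    colouring. *)
Definition transversal_label (a b : G) (i : 'I_3) : G :=
  match val i with 0 => a | 1 => b | _ => s - a - b end.

Definition transversal_triple (a b : G) : {set T * 'I_3} :=
  [set p | f p.1 == transversal_label a b p.2].

Definition tripled_blocks : {set {set T * 'I_3}} :=
  [set level_triple q.1 q.2 | q in setX [set: 'I_3] B]
  :|: [set transversal_triple q.1 q.2 | q : G * G].

(** One copy of [C] covers a single level, so its three copies together form one class. *)
Definition level_class (C : {set {set T}}) : {set {set T * 'I_3}} :=
  [set level_triple q.1 q.2 | q in setX [set: 'I_3] C].

Definition transversal_class (d : G) : {set {set T * 'I_3}} :=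
  [set transversal_triple a (a - d) | a : G].

Definition tripled_classes : {set {set {set T * 'I_3}}} :=
  [set level_class C | C in P] :|: [set transversal_class d | d : G].

Lemma tripled_blocksP (D : {set T * 'I_3}) :
  reflect ((exists i, exists2 b, b \in B & D = level_triple i b) \/
           exists a b, D = transversal_triple a b)
          (D \in tripled_blocks).
Proof.
rewrite inE; apply: (iffP orP) => -[].
- case/imsetP=> -[i b]; rewrite !inE /= => bB ->.
  by left; exists i, b.
- by case/imsetP=> -[a b] _ ->; right; exists a, b.
- by case=> i [b bB ->]; left; apply/imsetP; exists (i, b); rewrite // !inE.
- by case=> a [b ->]; right; apply/imsetP; exists (a, b).
Qed.

Lemma tripled_classesP (E : {set {set T * 'I_3}}) :
  reflect ((exists2 C, C \in P & E = level_class C) \/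
           exists d, E = transversal_class d)
          (E \in tripled_classes).
Proof.
rewrite inE; apply: (iffP orP) => -[].
- by case/imsetP=> C CP ->; left; exists C.
- by case/imsetP=> d _ ->; right; exists d.
- by case=> C CP ->; left; apply/imsetP; exists C.
- by case=> d ->; right; apply/imsetP; exists d.
Qed.

Lemma level_classP (C : {set {set T}}) (D : {set T * 'I_3}) :
  reflect (exists i, exists2 b, b \in C & D = level_triple i b)
          (D \in level_class C).
Proof.
apply: (iffP imsetP) => [[[i b]]|[i [b bC ->]]].
  by rewrite !inE /= => bC ->; exists i, b.
by exists (i, b); rewrite // !inE.
Qed.

Lemma card_level_triple i (b : {set T}) : #|level_triple i b| = #|b|.
Proof.
suff -> : level_triple i b = setX b [set i] by rewrite cardsX cards1 muln1.
by apply/setP => -[x j]; rewrite !inE.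
Qed.

Lemma mem_transversal_triple a b i :
  (g (transversal_label a b i), i) \in transversal_triple a b.
Proof. by rewrite inE /= gK. Qed.

Lemma card_transversal_triple a b : #|transversal_triple a b| = 3.
Proof.
suff -> : transversal_triple a b =
    [set (g (transversal_label a b i), i) | i : 'I_3].
  by rewrite card_imset ?card_ord // => i j [].
apply/setP => -[x i]; rewrite !inE /=; apply/eqP/imsetP => [xi|[j _ [-> ->]]].
  by exists i; rewrite // -xi fK.
exact: gK.
Qed.

(** Two labels determine the third through the sum [s], so a missing [a] or [b] is [s] minus the two
    given labels. *)
Lemma transversal_label_ex i j (u w : G) : i != j ->
  exists a b, transversal_label a b i = u /\ transversal_label a b j = w.
Proof.
have sub2 (x y z : G) : x - (x - y - z) - z = y.
  by rewrite !opprB addrCA [x + _]addrC subrK addrAC subrr add0r.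
have sub1 (x y z : G) : x - y - (x - y - z) = z by rewrite opprB addrC subrK.
case: i j => [[|[|[|//]]] ?] [[|[|[|//]]] ?] // _; rewrite /transversal_label /=.
- by exists u, w.
- by exists u, (s - u - w); split; rewrite // sub1.
- by exists w, u.
- by exists (s - w - u), u; split; rewrite // sub2.
- by exists w, (s - w - u); split; rewrite // sub1.
- by exists (s - u - w), w; split; rewrite // sub2.
Qed.

Lemma transversal_label_inj i j a b a' b' : i != j ->
  transversal_label a b i = transversal_label a' b' i ->
  transversal_label a b j = transversal_label a' b' j ->
  a = a' /\ b = b'.
Proof.
have subl (x y z t : G) : x = y -> s - x - z = s - y - t -> z = t.
  by move=> -> /addrI/oppr_inj.
have subr (x y z t : G) : z = t -> s - x - z = s - y - t -> x = y.
  by move=> -> /addIr/addrI/oppr_inj.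
case: i j => [[|[|[|//]]] ?] [[|[|[|//]]] ?] // _; rewrite /transversal_label /=.
all: move=> e1 e2; split=> //.
- exact: subl e1 e2.
- exact: subr e1 e2.
- exact: subl e2 e1.
- exact: subr e2 e1.
Qed.

Lemma transversal_triple_inj a b a' b' :
  transversal_triple a b = transversal_triple a' b' -> a = a' /\ b = b'.
Proof.
move=> e; have eqi i : transversal_label a b i = transversal_label a' b' i.
  have := mem_transversal_triple a b i; rewrite e inE /= gK.
  by move/eqP.
exact: (@transversal_label_inj ord0 ord_max).
Qed.

(** A transversal triple meets each level once, so it contains no pair lying on one level. *)
Lemma transversal_triple_level a b i j x y :
  (x, i) \in transversal_triple a b -> (y, j) \in transversal_triple a b ->
  i = j -> x = y.
Proof.
by rewrite !inE /= => /eqP xE /eqP yE ij; apply: (can_inj fK); rewrite xE yE ij.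
Qed.

Lemma level_neq_transversal i b a a' :
  level_triple i b != transversal_triple a a'.
Proof.
apply/eqP => e.
have := mem_transversal_triple a a' ord0.
have := mem_transversal_triple a a' ord_max.
by rewrite -e !inE /= => /andP[_ /eqP<-] /andP[_].
Qed.

(** The level is read off from a point of [b]; the empty set would give the same triple on every
    level. *)
Lemma level_triple_inj i i' (b b' : {set T}) : b \in B ->
  level_triple i b = level_triple i' b' -> i = i' /\ b = b'.
Proof.
case/(steiner_block_neq0 stsB) => x xb e.
have ii' : i = i'.
  move/setP/(_ (x, i)): (e); rewrite !inE /= xb eqxx /=.
  by case/esym/andP=> _ /eqP.
split=> //; apply/setP => y; move/setP/(_ (y, i)): (e).
by rewrite !inE /= -ii' eqxx !andbT.
Qed.

(** Two points on one level lie only in a level triple, given by their block in [B]. Two points on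
    different levels lie only in a transversal triple, fixed by their two labels. *)
Lemma tripled_steiner : steiner_triple_system tripled_blocks.
Proof.
apply: steiner_of_unique_block.
- move=> D /tripled_blocksP[[i [b bB ->]]|[a [b ->]]].
    by rewrite card_level_triple stsB.1.
  exact: card_transversal_triple.
- move=> [x i] [y j] xy; have [ij|ij] := eqVneq i j.
    have xy' : x != y by apply: contraNneq xy => ->; rewrite ij.
    have [b bB /andP[xb yb]] := steiner_block stsB xy'.
    exists (level_triple i b); last by rewrite !inE /= xb yb ij eqxx.
    by apply/tripled_blocksP; left; exists i, b.
  have [a [b [ai bj]]] := transversal_label_ex (f x) (f y) ij.
  exists (transversal_triple a b); last by rewrite !inE /= ai bj !eqxx.
  by apply/tripled_blocksP; right; exists a, b.
- move=> [x i] [y j] D D' xy.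
  case/tripled_blocksP=> [[k [b bB ->]]|[a [b ->]]];
  case/tripled_blocksP=> [[k' [b' b'B ->]]|[a' [b' ->]]].
  + rewrite !inE /= => /andP[/andP[xb /eqP ik] /andP[yb /eqP jk]].
    move=> /andP[/andP[xb' /eqP ik'] /andP[yb' _]].
    have xy' : x != y by apply: contraNneq xy => ->; rewrite ik jk.
    rewrite -ik -ik'; congr level_triple.
    by apply: (steiner_block_unique stsB xy'); rewrite // ?xb ?xb'.
  + move=> /[swap] /andP[xt yt].
    rewrite !inE /= => /andP[/andP[_ /eqP ik] /andP[_ /eqP jk]]; move: xy.
    by rewrite (transversal_triple_level xt yt) ?ik ?jk ?eqxx.
  + case/andP=> xt yt.
    rewrite !inE /= => /andP[/andP[_ /eqP ik] /andP[_ /eqP jk]]; move: xy.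
    by rewrite (transversal_triple_level xt yt) ?ik ?jk ?eqxx.
  + move=> /andP[xt yt] /andP[xt' yt'].
    have ij : i != j.
      by apply: contraNneq xy => ij; rewrite (transversal_triple_level xt yt) ?ij.
    move: xt yt xt' yt'; rewrite !inE /= => /eqP-> /eqP-> /eqP e1 /eqP e2.
    by have [-> ->] := transversal_label_inj ij e1 e2.
Qed.

Lemma class_sub_blocks (C : {set {set T}}) (b : {set T}) : C \in P -> b \in C -> b \in B.
Proof.
case: ktsBP => _ /and3P[/eqP <- _ _] _ CP bC.
by apply/bigcupP; exists C.
Qed.

Lemma level_class_parallel C : C \in P -> parallel_class (level_class C).
Proof.
move=> CP; have pC : partition C [set: T] by case: ktsBP => _ _; apply.
apply: partition_of_unique_cover => //.
- apply/level_classP => -[i [b bC e]].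
  have [x xb] := steiner_block_neq0 stsB (class_sub_blocks CP bC).
  by move/setP/(_ (x, i)): (e); rewrite !inE /= xb eqxx.
- move=> [x i] _; have [b bC xb] := partition_mem_cover pC (in_setT x).
  exists (level_triple i b); last by rewrite !inE /= xb eqxx.
  by apply/level_classP; exists i, b.
- move=> [x i] _ _ /level_classP[k [b bC ->]] /level_classP[k' [b' b'C ->]].
  rewrite !inE /= => /andP[xb /eqP<-] /andP[xb' /eqP<-].
  by rewrite (partition_mem_unique pC bC b'C xb xb').
Qed.

(** As [a] runs over [G], each of the labels [a], [a - d] and [s + d - (a + a)] takes every value
    once; the last because doubling is bijective. *)
Lemma transversal_class_parallel d : parallel_class (transversal_class d).
Proof.
have third a : s - a - (a - d) = s + d - (a + a).
  by rewrite opprB [d - a]addrC addrA [s + d]addrC opprD addrA addrC !addrA.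
apply: partition_of_unique_cover => //.
- apply/imsetP => -[a _ e].
  by have := mem_transversal_triple a (a - d) ord0; rewrite -e inE.
- move=> [x i] _.
  suff [a ea] : exists a, f x = transversal_label a (a - d) i.
    exists (transversal_triple a (a - d)); first exact: imset_f.
    by rewrite inE /= ea.
  case: i => [[|[|[|//]]] ?]; rewrite /transversal_label /=.
  + by exists (f x).
  + by exists (f x + d); rewrite addrK.
  (* [h] halves, so the witness solves [a + a = s + d - f x]. *)
  + have [h _ hK] := double_bij.
    by exists (h (s + d - f x)); rewrite third hK opprB addrC subrK.
- move=> [x i] _ _ /imsetP[a _ ->] /imsetP[a' _ ->].
  rewrite !inE /= => /eqP-> /eqP.
  suff aa' : transversal_label a (a - d) i = transversal_label a' (a' - d) i ->
      a = a' by move/aa' => ->.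
  case: i => [[|[|[|//]]] ?]; rewrite /transversal_label /= => //.
    exact: addIr.
  by rewrite !third => /addrI/oppr_inj/(bij_inj double_bij).
Qed.

(** A triple determines its class: a level triple through the class of [b] in [P], a transversal
    triple through [d = a - b]. *)
Lemma tripled_classes_partition : partition tripled_classes tripled_blocks.
Proof.
have [_ pP parP] := ktsBP.
apply: partition_of_unique_cover.
- apply/tripled_classesP => -[[C CP e]|[d e]].
    have /set0Pn[b bC] : C != set0.
      by apply: contraTneq CP => ->; case/and3P: pP.
    have : level_triple ord0 b \in level_class C.
      by apply/level_classP; exists ord0, b.
    by rewrite -e inE.
  have : transversal_triple 0 (0 - d) \in transversal_class d by apply: imset_f.
  by rewrite -e inE.
- move=> E /tripled_classesP[[C CP ->]|[d ->]]; apply/subsetP => D.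
    move=> /level_classP[i [b bC ->]]; apply/tripled_blocksP; left.
    by exists i, b; rewrite // (class_sub_blocks CP).
  by case/imsetP=> a _ ->; apply/tripled_blocksP; right; exists a, (a - d).
- move=> D /tripled_blocksP[[i [b bB ->]]|[a [b ->]]].
    have [C CP bC] := partition_mem_cover pP bB.
    exists (level_class C); last by apply/level_classP; exists i, b.
    by apply/tripled_classesP; left; exists C.
  exists (transversal_class (a - b)).
    by apply/tripled_classesP; right; exists (a - b).
  by apply/imsetP; exists a; rewrite // opprB addrC subrK.
- move=> D E E' /tripled_classesP[[C CP ->]|[d ->]];
  case/tripled_classesP=> [[C' C'P ->]|[d' ->]].
  + move=> /level_classP[i [b bC ->]] /level_classP[i' [b' b'C']].
    case/(level_triple_inj (class_sub_blocks CP bC)) => _ bb'.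
    by rewrite (partition_mem_unique pP CP C'P bC) // bb'.
  + move=> /level_classP[i [b bC ->]] /imsetP[a _ /eqP].
    by rewrite (negPf (level_neq_transversal _ _ _ _)).
  + move=> /imsetP[a _ ->] /level_classP[i [b bC /esym/eqP]].
    by rewrite (negPf (level_neq_transversal _ _ _ _)).
  + move=> /imsetP[a _ ->] /imsetP[a' _ /transversal_triple_inj[->]].
    by move/addrI/oppr_inj ->.
Qed.

Lemma tripled_kirkman : kirkman_triple_system tripled_blocks tripled_classes.
Proof.
split; [exact: tripled_steiner | exact: tripled_classes_partition |].
move=> E /tripled_classesP[[C CP ->]|[d ->]].
  exact: level_class_parallel.
exact: transversal_class_parallel.
Qed.

End Tripling.

(** Joins the finite and the additive structure on a product, so that ['I_3 * 'I_w.+1] can serve as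
    [G]. *)
HB.instance Definition _ (U V : finZmodType) := Finite.on (U * V)%type.

(** * Equitable colourings, labelling by colour, and doubling in odd groups *)

Section Colouring.

Import GRing.Theory.
Local Open Scope ring_scope.

Lemma sum_colour_classes (T : finType) (k : nat) (c : T -> 'I_k) :
  (\sum_(i < k) #|colour_class c i|)%N = #|T|.
Proof.
rewrite -sum1_card (partition_big c xpredT) //=; apply: eq_bigr => i _.
by rewrite -sum1_card; apply: eq_bigl => x; rewrite inE.
Qed.

(** If the least size is m, the total lies between 3m and 3m + 2; being divisible by 3, it forces
    all sizes to be equal. *)
Lemma equitable_class_card (T : finType) (v : nat) (c : T -> 'I_3) :
  equitable c -> #|T| = (3 * v)%N -> forall i, #|colour_class c i| = v.
Proof.
move=> eqc; rewrite -(sum_colour_classes c) !big_ord_recl big_ord0 => sumT i.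
set o1 := lift _ _ in sumT; set o2 := lift _ _ in sumT.
have := eqc ord0 o1; have := eqc ord0 o2; have := eqc o1 ord0.
have := eqc o1 o2; have := eqc o2 ord0; have := eqc o2 o1.
have [->|->|->] : [\/ i = ord0, i = o1 | i = o2].
  case: i => [[|[|[|//]]] ?]; [apply: Or31|apply: Or32|apply: Or33];
  exact: val_inj.
all: lia.
Qed.

(** The second coordinate is the position of the point in a listing of its colour class. The size is
    a successor so that ['I_w.+1] is a cyclic group. *)
Lemma colour_labelling (T : finType) (k w : nat) (c : T -> 'I_k) :
  (forall i, #|colour_class c i| = w.+1) ->
  exists2 f : T -> 'I_k * 'I_w.+1, bijective f & forall x, (f x).1 = c x.
Proof.
move=> cw; pose F x := enum (colour_class c (c x)).
(* [inord] has a default value out of range; [ltF] shows that it never occurs. *)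
exists (fun x => (c x, inord (index x (F x)))) => //.
have memF x : x \in F x by rewrite mem_enum inE.
have ltF x : (index x (F x) < w.+1)%N.
  by rewrite -(cw (c x)) cardE index_mem.
apply: inj_card_bij.
  move=> x y [cxy /(congr1 val) /=]; rewrite !inordK ?ltF // => e.
  have Fxy : F x = F y by rewrite /F cxy.
  by rewrite -(nth_index x (memF x)) e Fxy nth_index.
rewrite card_prod !card_ord -(sum_colour_classes c).
by rewrite (eq_bigr (fun=> w.+1)) // sum_nat_const card_ord.
Qed.

(** If a and b have equal doubles, a - b is killed by 2 and by the odd order of [G], hence is
    zero. *)
Lemma double_bij_odd (G : finZmodType) :
  odd #|G| -> bijective (fun a : G => a + a).
Proof.
move=> oddG; apply: injF_bij => a b eab.
have cardG0 (x : G) : x *+ #|G| = 0.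
  (* Translation by [x] permutes [G], so summing over [G] yields that [#|G|] kills [x]. *)
  have : (\sum_(y : G) (y + x) = \sum_(y : G) y).
    by rewrite [RHS](reindex_inj (addIr x)).
  rewrite big_split /= sumr_const => /eqP.
  by rewrite addrC -subr_eq0 addrK => /eqP.
apply/eqP; rewrite -subr_eq0; apply/eqP.
have d2 : (a - b) *+ 2 = 0 by rewrite mulrnBl !mulr2n eab subrr.
have := cardG0 (a - b); rewrite -[#|G|]odd_double_half oddG -mul2n.
by rewrite mulrnDr mulrnA d2 mul0rn addr0.
Qed.

Lemma monochromatic_level (T : finType) (c : T -> 'I_3) i (b : {set T}) :
  monochromatic (fun p : T * 'I_3 => c p.1) (level_triple i b) ->
  monochromatic c b.
Proof.
case=> k mono; exists k => x xb.
by apply: (mono (x, i)); rewrite !inE /= xb eqxx.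
Qed.

Lemma transversal_not_monochromatic (T : finType) (w : nat) (c : T -> 'I_3)
    (f : T -> 'I_3 * 'I_w.+1) (g : 'I_3 * 'I_w.+1 -> T) a b :
  cancel g f -> (forall x, (f x).1 = c x) ->
  ~ monochromatic (fun p : T * 'I_3 => c p.1)
      (transversal_triple f (1, 0) a b).
Proof.
move=> gK fc [k mono].
have lab i : (transversal_label (1, 0) a b i).1 = k.
  have := mono _ (mem_transversal_triple (1, 0) gK a b i).
  by rewrite /= -fc gK.
have e0 : a.1 = k := lab (@Ordinal 3 0 isT).
have e1 : b.1 = k := lab (@Ordinal 3 1 isT).
have : 1 - a.1 - b.1 = k := lab (@Ordinal 3 2 isT).
(* The equation 1 - k - k = k in Z/3 would give 1 = 3k = 0; it is refuted for each of the three
   values. *)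
by rewrite e0 e1 => /(congr1 val); case: k {mono lab e0 e1} => [[|[|[|]]]].
Qed.

End Colouring.

Theorem theorem2p3 (v : nat) (hv : 3 <= v)
    (hKTS : exists_equitably_3_colourable_KTS (3 * v)) :
  exists_equitably_3_colourable_KTS (9 * v).
Proof.
case: hKTS => T [B [P [cardT ktsBP [c [colc eqc]]]]].
have [stsB _ _] := ktsBP.
have classc := equitable_class_card eqc cardT.
case: v hv cardT classc => // w hv cardT classc.
have [f [g fK gK] fc] := colour_labelling classc.
have oddT : odd #|T|.
  have /card_gt0P[x _] : 0 < #|T| by rewrite cardT.
  exact: steiner_order_odd stsB x.
have dbl : bijective (fun a : 'I_3 * 'I_w.+1 => (a + a)%R).
  (* The labelling is a bijection, so the group has the odd order of [T]. *)
  apply: double_bij_odd; by rewrite -(bij_eq_card (Bijective fK gK)).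
pose s : 'I_3 * 'I_w.+1 := (1, 0)%R.
exists (T * 'I_3)%type, (tripled_blocks B f s), (tripled_classes P f s).
split; first by rewrite card_prod cardT card_ord; lia.
  exact: (tripled_kirkman ktsBP s fK gK dbl).
(* Each level repeats the old colouring, so every class becomes three copies of an old one and all
   sizes stay equal. *)
exists (fun p => c p.1); split.
  move=> D /tripled_blocksP[[i [b bB ->]]|[a [b ->]]].
    by move/monochromatic_level; apply: colc.
  exact: transversal_not_monochromatic gK fc.
move=> i j; suff card3 k :
    #|colour_class (fun p : T * 'I_3 => c p.1) k| = 3 * w.+1.
  by rewrite !card3 leq_addr.
suff -> : colour_class (fun p : T * 'I_3 => c p.1) k =
    setX (colour_class c k) [set: 'I_3].
  by rewrite cardsX classc cardsT card_ord mulnC.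
by apply/setP => -[x l]; rewrite !inE andbT.
Qed.
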